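(* Let $$T_X=\left[\begin{array}{c|c|c} & \vec{c}_a^{\,T} & \\ \vec{q} & X^{-1} & J\vec{q} \\ & \vec{c}_b^{\,T} & \end{array}\right]$$ be a given invertible $n\times n$ matrix, where $J$ is the flip matrix and $X$ is a discrete trigonometric transform (of order $n-2$) such that $JXJ=X$. Here the first column of $T_X$ is $\vec{q}\in\mathbb{R}^n$, the last column is $J\vec{q}$, and the middle $n-2$ columns form the $n\times(n-2)$ block whose first row is $\vec{c}_a^{\,T}$, whose last row is $\vec{c}_b^{\,T}$ (with $\vec{c}_a,\vec{c}_b\in\mathbb{C}^{n-2}$), and whose rows $2,\dots,n-1$ form the matrix $X^{-1}$. Then $T_X^{-1}\vec{y}$ can be computed in $O(n\log n)$ arithmetic operations for all $\vec{y}\in\mathbb{C}^n$.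
   Context: The flip matrix $J$ of order $k$ is the $k\times k$ permutation matrix with nontrivial entries $J_{i,k+1-i}=1$, $i=1,\dots,k$. The symbol $J$ denotes the flip matrix of whatever order is required: order $n$ in $J\vec{q}$, order $n-2$ in $JXJ=X$. A discrete trigonometric transform $X$ of order $n-2$ is the invertible $(n-2)\times(n-2)$ matrix of a fast trigonometric transform (Fourier, sine, cosine or Hartley type), so that the product of $X$ (or of $X^{-1}$) with any vector costs $O(n\log n)$ arithmetic operations. The asymptotic bound refers to a family of such matrices indexed by $n$, with a constant independent of $n$ and $\vec{y}$. The transform $X$ and the vectors $\vec{q},\vec{c}_a,\vec{c}_b$ are given data for each $n$. The vector $\vec{q}\in\mathbb{R}^n$ is the normalized uniform sampling of a quadratic function: $\vec{q}=\tilde{\vec{q}}/\|\tilde{\vec{q}}\|_2$ with $[\tilde{\vec{q}}]_{i+1}=(b-x_i)^2$ for $i=0,\dots,n-1$, where $a=x_0<x_1<\dots<x_{n-1}=b$ are $n$ equispaced points of an interval $[a,b]$. In particular $q_1\neq 0$ and $q_n=0$. *)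

(* Defs.v *)
From HB Require Import structures.
From mathcomp Require Import all_boot all_order all_algebra.
From mathcomp Require Import complex.
From mathcomp Require Import all_classical all_reals all_analysis.

Set Implicit Arguments.
Unset Strict Implicit.
Unset Printing Implicit Defensive.

Import Order.TTheory GRing.Theory Num.Theory numFieldNormedType.Exports.
Local Open Scope classical_set_scope.
Local Open Scope ring_scope.

Inductive arith_op := Add | Sub | Mul | Div.

Inductive operand (F : Type) := Cst of F | Reg of nat.
Arguments Reg {F}.

Record instr (F : Type) := Instr {
  iop : arith_op;
  lhs : operand F;
  rhs : operand F }.

(* Straight-line programs with p outputs.  Registers 0, ..., n - 1 hold the   *)
(* n inputs and the k-th instruction (from 0) writes register n + k.  Moving  *)
(* data and using a constant as an operand are free.                          *)
Record slp (F : Type) (p : nat) := Slp {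
  code : seq (instr F);
  out : 'I_p -> operand F }.

Section Semantics.
Variable F : fieldType.
Implicit Types (mem : seq F) (K : set F).

(* Reading an unwritten register and dividing by zero are errors, so that a   *)
(* program cannot exploit the convention 0^-1 = 0.                            *)
Definition read mem (o : operand F) : option F :=
  match o with Cst c => Some c | Reg k => onth mem k end.

Definition apply_op (o : arith_op) (x y : F) : option F :=
  match o with
  | Add => Some (x + y)
  | Sub => Some (x - y)
  | Mul => Some (x * y)
  | Div => if y == 0 then None else Some (x / y)
  end.

Definition step mem (s : instr F) : option (seq F) :=
  if (read mem (lhs s), read mem (rhs s)) is (Some x, Some y) then
    omap (rcons mem) (apply_op (iop s) x y)
  else None.

Definition exec (c : seq (instr F)) mem : option (seq F) :=
  foldl (fun om s => obind (step^~ s) om) (Some mem) c.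

Definition computes n p (P : slp F p) (y : 'cV[F]_n) (v : 'cV[F]_p) : Prop :=
  exists2 mem, exec (code P) [seq y i ord0 | i : 'I_n] = Some mem
             & forall i, read mem (out P i) = Some (v i ord0).

Definition operand_over K (o : operand F) : Prop :=
  if o is Cst c then K c else True.

Definition slp_over K p (P : slp F p) : Prop :=
  (forall k s, onth (code P) k = Some s ->
     operand_over K (lhs s) /\ operand_over K (rhs s)) /\
  (forall i, operand_over K (out P i)).

Definition cost p (P : slp F p) : nat := size (code P).

Definition flip k : 'M[F]_k := \matrix_(i, j) (j == rev_ord i)%:R.

Definition TX m (q : 'cV[F]_(1 + m + 1)) (X : 'M[F]_m) (ca cb : 'cV[F]_m) :
    'M[F]_(1 + m + 1) :=
  row_mx (row_mx q (col_mx (col_mx ca^T (invmx X)) cb^T)) (flip _ *m q).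

(* The numbers available at no cost to an algorithm for TX: the given vectors *)
(* and the constants K (such as twiddle factors) of the algorithm for X.      *)
Definition data m K (q : 'cV[F]_(1 + m + 1)) (ca cb : 'cV[F]_m) : set F :=
  K `|` range (fun i => q i ord0)
    `|` range (fun j => ca j ord0) `|` range (fun j => cb j ord0).

End Semantics.

Section Families.
Variable R : realType.

(* Throughout, the index m of a family stands for n - 2.                      *)
Definition nlogn (m : nat) : R := m.+2%:R * ln m.+2%:R.

(* The products of A m with vectors are computed by a program that depends on *)
(* m only, all of whose constants lie in K m.                                 *)
Definition fast_product (K : nat -> set R[i]) (d : nat -> nat)
    (A : forall m, 'M[R[i]]_(d m)) : Prop :=
  exists P : forall m, slp R[i] (d m),
    [/\ forall m, slp_over (K m) (P m),
        forall m (y : 'cV[R[i]]_(d m)), computes (P m) y (A m *m y)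
      & (fun m => (cost (P m))%:R : R) =O_\oo nlogn].

(* No formula for the entries of X m is imposed: any family of invertible     *)
(* matrices admitting fast algorithms in both directions is a fast transform. *)
Definition trig_transform (K : nat -> set R[i]) (X : forall m, 'M[R[i]]_m) :
    Prop :=
  [/\ forall m, X m \in unitmx,
      fast_product K X
    & fast_product K (fun m => invmx (X m))].

Definition grid (a b : R) n (i : 'I_n) : R := a + i%:R * ((b - a) / n.-1%:R).

Definition norm2 n (v : 'cV[R]_n) : R := Num.sqrt (\sum_i v i ord0 ^+ 2).

Definition quad_sample (a b : R) n : 'cV[R]_n :=
  \col_i (b - grid a b i) ^+ 2.

Definition qvec (a b : R) n : 'cV[R[i]]_n :=
  map_mx (real_complex R)
    ((norm2 (quad_sample a b n))^-1 *: quad_sample a b n).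

End Families.

(* Main.v *)
Require Import Defs.
From HB Require Import structures.
From mathcomp Require Import all_boot all_order all_algebra.
From mathcomp Require Import complex.
From mathcomp Require Import all_classical all_reals all_analysis.
From mathcomp Require Import zify ring.

Set Implicit Arguments.
Unset Strict Implicit.
Unset Printing Implicit Defensive.

Import Order.TTheory GRing.Theory Num.Theory numFieldNormedType.Exports.
Local Open Scope classical_set_scope.
Local Open Scope ring_scope.

(** Write the system [T v = y] in blocks, with first and last unknowns [alpha]
    and [beta], middle unknowns [w], and border columns [a] and [b].  Its middle
    rows read [alpha a' + X^-1 w + beta b' = y'], where the prime keeps the
    inner entries, hence
      [w = X y' - alpha X a' - beta X b'].
    Three products with [X] therefore reduce the system to its first and last
    rows, a [2 x 2] system for [alpha] and [beta].  The coefficients and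
    right-hand sides of that system are the values at [a], [b] and [y] of the two
    linear forms [z |-> z_first - ca^T X z'] and [z |-> z_last - cb^T X z'],
    which vanish on the middle columns of [T] ([first_form_bordered],
    [last_form_bordered]).  Since [T] is invertible the [2 x 2] system is onto, so
    its determinant is nonzero ([schur_det_neq0]), Cramer's rule applies and the
    only divisions are by that determinant.  The total is three products with
    [X] plus [O(n)] operations.

    To turn this into a straight-line program, a program is grown from the
    empty one while everything it has computed stays readable ([extends]).
    Two ways of growing suffice: inlining the program that multiplies by [X]
    ([extend_call]), and evaluating an arithmetic expression in readable
    quantities ([extend_expr]). *)

(** * Straight-line programs *)

Section Programs.
Variable F : fieldType.
Implicit Types (mem : seq F) (c : seq (instr F)) (ins : seq (operand F)).

Lemma exec_cat c1 c2 mem :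
  exec (c1 ++ c2) mem = obind (exec c2) (exec c1 mem).
Proof.
rewrite /exec foldl_cat; case: (foldl _ (Some mem) c1) => //=.
by elim: c2.
Qed.

Lemma exec_cons s c mem : exec (s :: c) mem = obind (exec c) (step mem s).
Proof. exact: (exec_cat [:: s]). Qed.

Lemma step_rcons mem mem' s : step mem s = Some mem' ->
  exists x, mem' = rcons mem x.
Proof.
rewrite /step; case: (read _ _) => // x; case: (read _ _) => // y.
by case: (apply_op _ _ _) => //= z [<-]; exists z.
Qed.

Lemma read_rcons mem x o z :
  read mem o = Some z -> read (rcons mem x) o = Some z.
Proof.
case: o => //= k hk; rewrite -cats1 onth_cat -onthTE hk //.
Qed.

Lemma size_exec c mem mem' :
  exec c mem = Some mem' -> size mem' = (size mem + size c)%N.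
Proof.
elim: c mem => [|s c IH] mem; first by case=> ->; rewrite addn0.
rewrite exec_cons; case E: (step mem s) => [mem1|] //= /IH ->.
by have [x ->] := step_rcons E; rewrite size_rcons addnS.
Qed.

Lemma read_exec c mem mem' o x : exec c mem = Some mem' ->
  read mem o = Some x -> read mem' o = Some x.
Proof.
elim: c mem => [|s c IH] mem; first by case=> ->.
rewrite exec_cons; case E: (step mem s) => [mem1|] //= h1 h2.
apply: IH h1 _; have [z ->] := step_rcons E.
exact: read_rcons.
Qed.

Lemma read_new mem x : read (rcons mem x) (Reg (size mem)) = Some x.
Proof. by rewrite /= -cats1 onth_cat ltnn subnn. Qed.

(** Inlines a program into a larger one at a point where [off] registers are in
    use: its inputs become the operands [ins], and the registers that it writes
    become those from [off] on. *)
Definition relocate ins off (o : operand F) : operand F :=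
  if o is Reg k then nth (Reg (off + (k - size ins))) ins k else o.

Definition relocate_instr ins off (s : instr F) : instr F :=
  Instr (iop s) (relocate ins off (lhs s)) (relocate ins off (rhs s)).

(** Simulation invariant between the memory [L] of the inlined program run on
    its own and the memory [M] of the program that hosts it. *)
Definition simulates ins off (M L : seq F) : Prop :=
  [/\ (size ins <= size L)%N, (size M + size ins = off + size L)%N
    & forall o x, read L o = Some x -> read M (relocate ins off o) = Some x].

Lemma step_relocate ins off s M L L' :
  simulates ins off M L -> step L s = Some L' ->
  exists2 M', step M (relocate_instr ins off s) = Some M'
            & simulates ins off M' L'.
Proof.
move=> [le_ins szM sim]; rewrite /step /=.
case E1: (read L (lhs s)) => [x|] //; case E2: (read L (rhs s)) => [y|] //.
rewrite (sim _ _ E1) (sim _ _ E2).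
case: (apply_op _ _ _) => //= z [<-]; exists (rcons M z) => //.
split; rewrite ?size_rcons; [exact: leqW | by rewrite addSn szM addnS |].
case=> //= k t; rewrite -[rcons L z]cats1 onth_cat.
case: ltnP => [_ h|lek]; first exact/read_rcons/(sim (Reg k)).
case E: (k - size L)%N => [|j]; last by rewrite /= onth0n.
have -> : k = size L by apply/eqP; rewrite eqn_leq lek -subn_eq0 E.
move=> [<-]; rewrite nth_default //.
(* The value just written by the inlined program is the newest register of both
   memories. *)
have -> : (off + (size L - size ins))%N = size M by lia.
exact: read_new.
Qed.

Lemma exec_relocate ins off c M L L' :
  simulates ins off M L -> exec c L = Some L' ->
  exists2 M', exec (map (relocate_instr ins off) c) M = Some M'
            & simulates ins off M' L'.
Proof.
elim: c M L => [|s c IH] M L sim; first by move=> [<-]; exists M.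
rewrite exec_cons; case E: (step L s) => [L1|] //= h.
have [M1 e1 sim1] := step_relocate sim E.
have [M' e2 sim2] := IH _ _ sim1 h.
by exists M' => //; rewrite exec_cons e1.
Qed.

Definition inputs n (y : 'cV[F]_n) : seq F := [seq y i ord0 | i : 'I_n].

Lemma size_inputs n (y : 'cV[F]_n) : size (inputs y) = n.
Proof. by rewrite size_image card_ord. Qed.

Lemma read_input n (y : 'cV[F]_n) (i : 'I_n) :
  read (inputs y) (Reg i) = Some (y i ord0).
Proof.
rewrite /= /inputs /image_mem onth_map onthE (nth_map i) ?size_enum_ord //=.
by rewrite nth_ord_enum.
Qed.

Section Extensions.
Variables (K : set F) (n : nat).
Implicit Types f g : 'cV[F]_n -> F.

Definition code_over c : Prop := forall k s, onth c k = Some s ->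
  operand_over K (lhs s) /\ operand_over K (rhs s).

Definition valid c : Prop :=
  code_over c /\
  (forall y : 'cV[F]_n, exists mem, exec c (inputs y) = Some mem).

(** The operand must be the same for all inputs [y]: it is part of the program,
    not of the run. *)
Definition readable c f : Prop :=
  exists2 o, operand_over K o &
    forall y mem, exec c (inputs y) = Some mem -> read mem o = Some (f y).

(** Registers are never overwritten, so a program is designed by growing a valid
    code while what it has computed stays available; [N] bounds the price. *)
Definition extends N c c' : Prop :=
  [/\ valid c', (size c' <= size c + N)%N & readable c `<=` readable c'].

Lemma extends_refl c : valid c -> extends 0 c c.
Proof. by split => //; rewrite addn0. Qed.

Lemma extends_trans N1 N2 c1 c2 c3 :
  extends N1 c1 c2 -> extends N2 c2 c3 -> extends (N1 + N2) c1 c3.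
Proof.
move=> [_ s12 r12] [v3 s23 r23]; split => //; first lia.
by move=> f /r12/r23.
Qed.

Lemma valid_nil : valid [::].
Proof. by split => [k s|y]; [rewrite onth0n | exists (inputs y)]. Qed.

Lemma readable_input c i : readable c (fun y => y i ord0).
Proof.
exists (Reg i) => // y mem h.
exact: read_exec h (read_input y i).
Qed.

Lemma readable_cst c z : K z -> readable c (fun=> z).
Proof. by exists (Cst z). Qed.

Lemma readable_cat c c' : readable c `<=` readable (c ++ c').
Proof.
move=> f [r Kr h]; exists r => // y mem'; rewrite exec_cat.
case E: (exec c _) => [mem|] //= h'; exact: read_exec h' (h _ _ E).
Qed.

Lemma code_over_cat c1 c2 :
  code_over c1 -> code_over c2 -> code_over (c1 ++ c2).
Proof.
move=> h1 h2 k s; rewrite onth_cat; case: ifP => _; [exact: h1 | exact: h2].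
Qed.

Lemma operand_over_relocate ins off o :
  (forall k, operand_over K (nth (Reg off) ins k)) ->
  operand_over K o -> operand_over K (relocate ins off o).
Proof.
case: o => //= k h _; case: (ltnP k (size ins)) => hk.
  by rewrite (set_nth_default (Reg off)).
by rewrite nth_default.
Qed.

Lemma code_over_relocate ins off c :
  (forall k, operand_over K (nth (Reg off) ins k)) ->
  code_over c -> code_over (map (relocate_instr ins off) c).
Proof.
move=> hins hc k s; rewrite onth_map; case E: (onth c k) => [s'|] //= [<-].
by have [h1 h2] := hc _ _ E; split; apply: operand_over_relocate.
Qed.

(** The operands [a i] that hold the argument [x y] do not depend on [y], so a
    single relocated copy of [P] serves all inputs. *)
Lemma extend_call d p (P : slp F p) (v : 'cV[F]_d -> 'cV[F]_p)
    (x : 'cV[F]_n -> 'cV[F]_d) c :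
  slp_over K P -> (forall z, computes P z (v z)) -> valid c ->
  (forall i, readable c (fun y => x y i ord0)) ->
  exists2 c', extends (cost P) c c'
            & forall i, readable c' (fun y => v (x y) i ord0).
Proof.
move=> [Kcode Kout] hP [Kc runs] rx.
have /choice[a ha] : forall i, exists o, operand_over K o /\ forall y mem,
    exec c (inputs y) = Some mem -> read mem o = Some (x y i ord0).
  by move=> i; have [r ? ?] := rx i; exists r.
pose ins := [seq a i | i : 'I_d]; pose off := (n + size c)%N.
have sz_ins : size ins = d by rewrite size_image card_ord.
have Kins k : operand_over K (nth (Reg off) ins k).
  case: (ltnP k d) => hk; last by rewrite nth_default ?sz_ins.
  rewrite (nth_map (Ordinal hk)) ?size_enum_ord //; exact: (ha _).1.
have run (y : 'cV[F]_n) mem : exec c (inputs y) = Some mem -> exists mem',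
    [/\ exec (c ++ map (relocate_instr ins off) (Defs.code P)) (inputs y)
          = Some mem'
      & forall i, read mem' (relocate ins off (out P i)) = Some (v (x y) i ord0)].
  move=> hmem; have [L hL hout] := hP (x y).
  have sim : simulates ins off mem (inputs (x y)).
    split; rewrite ?size_inputs ?sz_ins //.
      by rewrite (size_exec hmem) size_inputs.
    case=> //= k z hk; case: (ltnP k d) => hkd; last first.
      by rewrite onth_default ?size_inputs in hk.
    move: (read_input (x y) (Ordinal hkd)); rewrite /= hk => -[->].
    rewrite (nth_map (Ordinal hkd)) ?size_enum_ord //.
    rewrite -[X in nth _ _ X]/(nat_of_ord (Ordinal hkd)) nth_ord_enum.
    exact: (ha _).2.
  have [M e [_ _ simM]] := exec_relocate sim hL.
  by exists M; rewrite exec_cat hmem; split => // i; apply/simM/hout.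
exists (c ++ map (relocate_instr ins off) (Defs.code P)).
  split; last exact: readable_cat.
    split; first exact/code_over_cat/code_over_relocate.
    by move=> y; have [mem /run[mem' [h _]]] := runs y; exists mem'.
  by rewrite size_cat size_map.
move=> i; exists (relocate ins off (out P i)).
  exact: operand_over_relocate.
move=> y mem'; have [mem /run[M [-> hM]]] := runs y.
by move=> [<-].
Qed.

Definition op_val (o : arith_op) (x y : F) : F :=
  match o with
  | Defs.Add => x + y
  | Defs.Sub => x - y
  | Defs.Mul => x * y
  | Defs.Div => x / y
  end.

Lemma extend_op o f g c :
  valid c -> readable c f -> readable c g ->
  (o = Defs.Div -> forall y, g y != 0) ->
  exists2 c', extends 1 c c' & readable c' (fun y => op_val o (f y) (g y)).
Proof.
move=> [Kc runs] [uf Kf hf] [ug Kg hg] hdiv.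
have run (y : 'cV[F]_n) mem : exec c (inputs y) = Some mem ->
    exec (c ++ [:: Instr o uf ug]) (inputs y)
    = Some (rcons mem (op_val o (f y) (g y))).
  move=> h; rewrite exec_cat h /= exec_cons /step /= (hf _ _ h) (hg _ _ h).
  by case: o hdiv => //= /(_ erefl y)/negPf ->.
exists (c ++ [:: Instr o uf ug]).
  split; [split | by rewrite size_cat | exact: readable_cat].
    by apply: code_over_cat => // k s /onth1P[_ <-].
  by move=> y; have [mem /run h] := runs y; eexists; exact: h.
exists (Reg (n + size c)) => // y mem'; have [mem h] := runs y.
rewrite (run _ _ h) => -[<-].
by rewrite -(size_inputs y) -(size_exec h) read_new.
Qed.

Lemma slp_of_readable p (v : 'cV[F]_n -> 'cV[F]_p) c :
  valid c -> (forall i, readable c (fun y => v y i ord0)) ->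
  exists P : slp F p, [/\ slp_over K P, forall y, computes P y (v y)
                        & cost P = size c].
Proof.
move=> [Kc runs] hv.
have /choice[a ha] : forall i, exists o, operand_over K o /\ forall y mem,
    exec c (inputs y) = Some mem -> read mem o = Some (v y i ord0).
  by move=> i; have [r ? ?] := hv i; exists r.
exists (Slp c a); split => //; first by split => // i; have [] := ha i.
move=> y; have [mem h] := runs y; exists mem => // i.
by have [_] := ha i; apply.
Qed.

(** The leaves are arbitrary functions of the input, to be read from registers or
    constants, so that an expression may use any earlier result for free. *)
Inductive expr :=
  | Val of ('cV[F]_n -> F)
  | Node of arith_op & expr & expr.

Fixpoint value (e : expr) (y : 'cV[F]_n) : F :=
  match e with
  | Val f => f y
  | Node o e1 e2 => op_val o (value e1 y) (value e2 y)
  end.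

Fixpoint ops (e : expr) : nat :=
  if e is Node _ e1 e2 then (ops e1 + ops e2).+1 else 0.

(** Programs stop at a division by zero, hence the condition on quotients. *)
Fixpoint evaluable c (e : expr) : Prop :=
  match e with
  | Val f => readable c f
  | Node o e1 e2 => [/\ evaluable c e1, evaluable c e2
                       & o = Defs.Div -> forall y, value e2 y != 0]
  end.

Lemma evaluableS c c' e :
  readable c `<=` readable c' -> evaluable c e -> evaluable c' e.
Proof.
by move=> h; elim: e => [f /h //|o e1 IH1 e2 IH2 /= [/IH1 ? /IH2 ? ?]].
Qed.

Lemma extend_expr e c : valid c -> evaluable c e ->
  exists2 c', extends (ops e) c c' & readable c' (value e).
Proof.
elim: e c => [f|o e1 IH1 e2 IH2] c vc /=.
  by exists c => //; apply: extends_refl.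
move=> [ev1 ev2 hdiv].
have [c1 x1 r1] := IH1 _ vc ev1; have [vc1 _ sub1] := x1.
have [c2 x2 r2] := IH2 _ vc1 (evaluableS sub1 ev2); have [vc2 _ sub2] := x2.
have [c3 x3 r3] := extend_op vc2 (sub2 _ r1) r2 hdiv.
exists c3 => //; rewrite -addn1.
exact: extends_trans (extends_trans x1 x2) x3.
Qed.

Lemma extend_exprs p k (e : 'I_p -> expr) c :
  valid c -> (forall i, evaluable c (e i)) -> (forall i, ops (e i) <= k)%N ->
  exists2 c', extends (p * k) c c' & forall i, readable c' (value (e i)).
Proof.
move=> vc ev hk.
suff [c' x h] : exists2 c', extends (size (enum 'I_p) * k) c c'
    & forall i, i \in enum 'I_p -> readable c' (value (e i)).
  exists c'; first by rewrite size_enum_ord in x.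
  by move=> i; apply: h; rewrite mem_enum.
elim: (enum 'I_p) => [|i s [c1 x1 h1]].
  by exists c; first exact: extends_refl.
have [vc1 s1 sub1] := x1.
have [c2 [vc2 s2 sub2] r2] := extend_expr vc1 (evaluableS sub1 (ev i)).
exists c2.
  have hki := hk i; split => //; last by move=> f /sub1/sub2.
  by rewrite /= mulSn addnCA addnC; apply: leq_trans s2 (leq_add s1 hki).
move=> j; rewrite inE => /orP[/eqP -> //|/h1/sub2 //].
Qed.

(** A dot product is only ever subtracted from a given quantity: the accumulation
    then needs no constant [0], which might not be among the constants [K]. *)
Definition sub_dot m (e : expr) (g h : 'I_m -> 'cV[F]_n -> F) : expr :=
  foldl (fun e j => Node Defs.Sub e (Node Defs.Mul (Val (g j)) (Val (h j))))
    e (enum 'I_m).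

Lemma value_sub_dot m e (g h : 'I_m -> 'cV[F]_n -> F) y :
  value (sub_dot e g h) y = value e y - \sum_j g j y * h j y.
Proof.
rewrite /sub_dot -[in RHS]big_enum /=; elim: (enum 'I_m) e => [|j s IH] e.
  by rewrite big_nil subr0.
by rewrite /= IH big_cons /= opprD addrA.
Qed.

Lemma ops_sub_dot m e (g h : 'I_m -> 'cV[F]_n -> F) :
  ops (sub_dot e g h) = (ops e + 2 * m)%N.
Proof.
rewrite /sub_dot -[in RHS](size_enum_ord m).
by elim: (enum 'I_m) e => [|j s IH] e /=; rewrite ?IH /=; lia.
Qed.

Lemma evaluable_sub_dot m e (g h : 'I_m -> 'cV[F]_n -> F) c :
  evaluable c e -> (forall j, readable c (g j)) -> (forall j, readable c (h j)) ->
  evaluable c (sub_dot e g h).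
Proof.
move=> + hg hh; rewrite /sub_dot.
by elim: (enum 'I_m) e => //= j s IH e he; apply: IH; split => //=; split.
Qed.

End Extensions.
End Programs.

(** * Elimination in a bordered system *)

Section Bordered.
Variable F : fieldType.
Variable m : nat.
Implicit Types (z : 'cV[F]_(1 + m + 1)).

Definition first_entry z : F := z (lshift 1 (lshift m ord0)) ord0.
Definition last_entry z : F := z (rshift (1 + m) ord0) ord0.
Definition inner z : 'cV[F]_m := dsubmx (usubmx z).

Lemma innerE z j : inner z j ord0 = z (lshift 1 (rshift 1 j)) ord0.
Proof. by rewrite !mxE. Qed.

Variables (X : 'M[F]_m) (ca cb : 'cV[F]_m) (a b : 'cV[F]_(1 + m + 1)).
Hypothesis Xunit : X \in unitmx.

Definition bordered : 'M[F]_(1 + m + 1) :=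
  row_mx (row_mx a (col_mx (col_mx ca^T (invmx X)) cb^T)) b.

(** The first and last rows of the system after block elimination: these two
    linear forms vanish on the middle columns of [bordered]. *)
Definition first_form z : F :=
  first_entry z - \sum_j ca j ord0 * (X *m inner z) j ord0.
Definition last_form z : F :=
  last_entry z - \sum_j cb j ord0 * (X *m inner z) j ord0.

Lemma bordered_mulE v i :
  (bordered *m v) i ord0
  = a i ord0 * first_entry v
    + \sum_j col_mx (col_mx ca^T (invmx X)) cb^T i j * inner v j ord0
    + b i ord0 * last_entry v.
Proof.
rewrite mxE !big_split_ord /= !big_ord1 /bordered; congr (_ + _ + _).
- by rewrite !row_mxEl.
- by apply: eq_bigr => j _; rewrite row_mxEl row_mxEr innerE.
- by rewrite row_mxEr.
Qed.

(** Applying [X] to the middle rows of the system eliminates its middle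
    unknowns. *)
Lemma bordered_inner v :
  inner v = X *m inner (bordered *m v) - first_entry v *: (X *m inner a)
            - last_entry v *: (X *m inner b).
Proof.
have -> : inner (bordered *m v)
    = first_entry v *: inner a + invmx X *m inner v + last_entry v *: inner b.
  apply/colP => j; rewrite innerE bordered_mulE !mxE -!innerE !innerE.
  rewrite [_ * first_entry v]mulrC [_ * last_entry v]mulrC.
  congr (_ + _ + _); apply: eq_bigr => k _.
  by rewrite col_mxEu col_mxEd innerE.
rewrite !mulmxDr mulKVmx // -!scalemxAr.
by rewrite addrAC addrK [_ - first_entry v *: _]addrC addKr.
Qed.

Lemma mul_inner_bordered v j :
  (X *m inner (bordered *m v)) j ord0
  = inner v j ord0 + first_entry v * (X *m inner a) j ord0
    + last_entry v * (X *m inner b) j ord0.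
Proof. by rewrite [in inner v]bordered_inner !mxE; ring. Qed.

Lemma sum_mul_inner_bordered (c : 'cV[F]_m) v :
  \sum_j c j ord0 * (X *m inner (bordered *m v)) j ord0
  = \sum_j c j ord0 * inner v j ord0
    + (\sum_j c j ord0 * (X *m inner a) j ord0) * first_entry v
    + (\sum_j c j ord0 * (X *m inner b) j ord0) * last_entry v.
Proof.
rewrite !mulr_suml -!big_split /=; apply: eq_bigr => j _.
by rewrite mul_inner_bordered; ring.
Qed.

Lemma first_form_bordered v :
  first_form (bordered *m v)
  = first_form a * first_entry v + first_form b * last_entry v.
Proof.
rewrite /first_form sum_mul_inner_bordered {1}/first_entry bordered_mulE.
under eq_bigr do rewrite !col_mxEu mxE.
by rewrite -/(first_entry a) -/(first_entry b); ring.
Qed.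

Lemma last_form_bordered v :
  last_form (bordered *m v)
  = last_form a * first_entry v + last_form b * last_entry v.
Proof.
rewrite /last_form sum_mul_inner_bordered {1}/last_entry bordered_mulE.
under eq_bigr do rewrite col_mxEd mxE.
by rewrite -/(last_entry a) -/(last_entry b); ring.
Qed.

(** The determinant of the [2 x 2] Schur complement of the block [invmx X]. *)
Definition schur_det : F :=
  first_form a * last_form b - first_form b * last_form a.

Definition border_vec (x y : F) : 'cV[F]_(1 + m + 1) :=
  col_mx (col_mx x%:M 0) y%:M.

Lemma forms_border_vec x y :
  first_form (border_vec x y) = x /\ last_form (border_vec x y) = y.
Proof.
have inner0 : X *m inner (border_vec x y) = 0.
  by rewrite /inner col_mxKu col_mxKd mulmx0.
split; rewrite /first_form /last_form inner0 big1 ?subr0.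
- by rewrite /first_entry !col_mxEu mxE.
- by move=> j _; rewrite mxE mulr0.
- by rewrite /last_entry col_mxEd mxE.
- by move=> j _; rewrite mxE mulr0.
Qed.

(** Any pair [(x, y)] is the value of the two forms at some right-hand side
    ([border_vec x y]), for which the full system is solvable: the [2 x 2] system
    is onto, and its determinant is inverted by that of the solutions for
    [(1, 0)] and [(0, 1)]. *)
Lemma schur_det_neq0 : bordered \in unitmx -> schur_det != 0.
Proof.
move=> uT.
have sol x y : exists p : F * F, first_form a * p.1 + first_form b * p.2 = x
    /\ last_form a * p.1 + last_form b * p.2 = y.
  pose v := invmx bordered *m border_vec x y.
  exists (first_entry v, last_entry v).
  rewrite -first_form_bordered -last_form_bordered mulKVmx //.
  exact: forms_border_vec.
have [[s1 s2] /= [s10 s20]] := sol 1 0; have [[t1 t2] /= [t10 t20]] := sol 0 1.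
have : schur_det * (s1 * t2 - s2 * t1) = 1.
  have -> : schur_det * (s1 * t2 - s2 * t1)
      = (first_form a * s1 + first_form b * s2)
        * (last_form a * t1 + last_form b * t2)
        - (first_form a * t1 + first_form b * t2)
          * (last_form a * s1 + last_form b * s2) by rewrite /schur_det; ring.
  by rewrite s10 s20 t10 t20 !mulr1 mulr0 subr0.
by apply: contra_eq_neq => ->; rewrite mul0r eq_sym oner_eq0.
Qed.

Lemma first_entry_bordered v : schur_det != 0 ->
  first_entry v
  = (last_form b * first_form (bordered *m v)
     - first_form b * last_form (bordered *m v)) / schur_det.
Proof.
move=> D0; apply: (mulIf D0); rewrite divfK // first_form_bordered.
by rewrite last_form_bordered /schur_det; ring.
Qed.

Lemma last_entry_bordered v : schur_det != 0 ->
  last_entry v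
  = (first_form a * last_form (bordered *m v)
     - last_form a * first_form (bordered *m v)) / schur_det.
Proof.
move=> D0; apply: (mulIf D0); rewrite divfK // first_form_bordered.
by rewrite last_form_bordered /schur_det; ring.
Qed.

End Bordered.

(** * The program for a bordered system *)

Section BorderedProgram.
Variables (F : fieldType) (K : set F) (m : nat).
Variables (X : 'M[F]_m) (ca cb : 'cV[F]_m) (a b : 'cV[F]_(1 + m + 1)).
Variable P : slp F m.
Hypotheses (Xunit : X \in unitmx) (Tunit : bordered X ca cb a b \in unitmx).
Hypotheses (KP : slp_over K P) (PX : forall z, computes P z (X *m z)).
Hypotheses (Ka : forall i, K (a i ord0)) (Kb : forall i, K (b i ord0)).
Hypotheses (Kca : forall i, K (ca i ord0)) (Kcb : forall i, K (cb i ord0)).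

Let N := (1 + m + 1)%N.

Definition form_expr (c : 'cV[F]_m) (i : 'I_N) (z : 'cV[F]_N -> 'cV[F]_N) :
    expr F N :=
  sub_dot (Val (fun y => z y i ord0)) (fun j _ => c j ord0)
    (fun j y => (X *m inner (z y)) j ord0).

Definition readable_mx p (c : seq (instr F)) (z : 'cV[F]_N -> 'cV[F]_p) : Prop :=
  forall i, readable K c (fun y => z y i ord0).

Lemma readable_mxS p c c' (z : 'cV[F]_N -> 'cV[F]_p) :
  readable K (n := N) c `<=` readable K c' -> readable_mx c z -> readable_mx c' z.
Proof. by move=> sub h i; apply/sub/h. Qed.

Lemma extend_mul_inner c z : valid K N c -> readable_mx c z ->
  exists2 c', extends K N (cost P) c c'
            & readable_mx c' (fun y => X *m inner (z y)).
Proof.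
move=> vc rz; apply: (extend_call (x := fun y => inner (z y)) KP PX vc) => j.
rewrite (_ : (fun y => _) = fun y => z y (lshift 1 (rshift 1 j)) ord0) //.
by apply/funext => y; rewrite innerE.
Qed.

Lemma evaluable_form_expr c i z (d : 'cV[F]_m) :
  (forall j, K (d j ord0)) ->
  readable_mx c z -> readable_mx c (fun y => X *m inner (z y)) ->
  evaluable K c (form_expr d i z).
Proof.
move=> Kd rz rXz; apply: evaluable_sub_dot => [|j|j].
- exact: rz.
- exact: readable_cst.
- exact: rXz.
Qed.

Let first_expr := form_expr ca (lshift 1 (lshift m ord0)).
Let last_expr := form_expr cb (rshift (1 + m) ord0).
Let sub_expr (e1 e2 : expr F N) := Node Defs.Sub e1 e2.
Let mul_expr (e1 e2 : expr F N) := Node Defs.Mul e1 e2.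
Let div_expr (e1 e2 : expr F N) := Node Defs.Div e1 e2.

Let value_first z y : value (first_expr z) y = first_form X ca (z y).
Proof. by rewrite value_sub_dot. Qed.

Let value_last z y : value (last_expr z) y = last_form X cb (z y).
Proof. by rewrite value_sub_dot. Qed.

(** The forms are recomputed at each of their occurrences in the quotients for
    [alpha] and [beta]: this only affects the constant in the linear term. *)
Lemma slp_solve_bordered : exists Q : slp F N,
  [/\ slp_over K Q, forall y, computes Q y (invmx (bordered X ca cb a b) *m y)
    & (cost Q <= 3 * cost P + 36 * m.+1)%N].
Proof.
set T := bordered X ca cb a b.
have D0 := schur_det_neq0 Xunit Tunit.
have v0 := valid_nil K N.
have ry c : readable_mx c id by move=> i; apply: readable_input.
have ra c : readable_mx c (fun=> a) by move=> i; apply: readable_cst.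
have rb c : readable_mx c (fun=> b) by move=> i; apply: readable_cst.
have [c1 x1 ry1] := extend_mul_inner v0 (ry [::]); have [v1 _ _] := x1.
have [c2 x2 ra2] := extend_mul_inner v1 (ra c1); have [v2 _ sub2] := x2.
have [c3 x3 rb3] := extend_mul_inner v2 (rb c2); have [v3 _ sub3] := x3.
have ry3 := readable_mxS sub3 (readable_mxS sub2 ry1).
have ra3 := readable_mxS sub3 ra2.
pose det := sub_expr (mul_expr (first_expr (fun=> a)) (last_expr (fun=> b)))
                 (mul_expr (first_expr (fun=> b)) (last_expr (fun=> a))).
have det_neq0 y : value det y != 0 by rewrite /= !value_first !value_last.
pose alpha := div_expr (sub_expr (mul_expr (last_expr (fun=> b)) (first_expr id))
                         (mul_expr (first_expr (fun=> b)) (last_expr id))) det.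
pose beta := div_expr (sub_expr (mul_expr (first_expr (fun=> a)) (last_expr id))
                        (mul_expr (last_expr (fun=> a)) (first_expr id))) det.
have val_alpha y : value alpha y = first_entry (invmx T *m y).
  rewrite (first_entry_bordered Xunit _ D0) -/T mulKVmx //=.
  by rewrite !value_first !value_last.
have val_beta y : value beta y = last_entry (invmx T *m y).
  rewrite (last_entry_bordered Xunit _ D0) -/T mulKVmx //=.
  by rewrite !value_first !value_last.
have ev_alpha : evaluable K c3 alpha.
  by do !split => //; apply: evaluable_form_expr.
have ev_beta : evaluable K c3 beta.
  by do !split => //; apply: evaluable_form_expr.
have [c4 x4 ralpha] := extend_expr v3 ev_alpha; have [v4 _ sub4] := x4.
have [c5 x5 rbeta] := extend_expr v4 (evaluableS sub4 ev_beta).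
have [v5 _ sub5] := x5.
pose w j := sub_expr (sub_expr (Val (fun y => (X *m inner y) j ord0))
    (mul_expr (Val (value alpha)) (Val (fun=> (X *m inner a) j ord0))))
    (mul_expr (Val (value beta)) (Val (fun=> (X *m inner b) j ord0))).
have val_w j y : value (w j) y = (X *m inner y) j ord0
    - value alpha y * (X *m inner a) j ord0
    - value beta y * (X *m inner b) j ord0 by [].
have sub45 : readable K (n := N) c3 `<=` readable K c5 by move=> f /sub4/sub5.
have ev_w j : evaluable K c5 (w j).
  do !split => //.
  - exact: (readable_mxS sub45 ry3).
  - exact: sub5.
  - exact: (readable_mxS sub45 ra3).
  - exact: (readable_mxS sub45 rb3).
have [c6 x6 rw] := extend_exprs v5 ev_w (k := 4) (fun=> isT).
have [v6 _ sub6] := x6.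
(* The entries of the solution are [alpha], the [w j] and [beta]. *)
have [|Q [KQ Qc costQ]] := slp_of_readable (v := fun y => invmx T *m y) v6.
  move=> i; case: (split_ordP i) => [{}i ->|j ->].
    case: (split_ordP i) => [j ->|j ->].
      rewrite (_ : (fun y => _) = value alpha); first exact/sub6/sub5.
      by apply/funext => y; rewrite val_alpha /first_entry ord1.
    rewrite (_ : (fun y => _) = value (w j)) //.
    apply/funext => y; rewrite -innerE (bordered_inner ca cb a b Xunit) -/T.
    rewrite mulKVmx // val_w val_alpha val_beta.
    by move: (X *m inner y) (X *m inner a) (X *m inner b) => U V W; rewrite !mxE.
  rewrite (_ : (fun y => _) = value beta); first exact/sub6.
  by apply/funext => y; rewrite val_beta /last_entry ord1.
exists Q; split => //.
have [_ + _] := extends_trans (extends_trans (extends_trans x1 x2) x3)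
  (extends_trans (extends_trans x4 x5) x6).
rewrite costQ /= !ops_sub_dot /=; lia.
Qed.

End BorderedProgram.

(** * Asymptotic cost *)

Section Asymptotics.
Variable R : realType.

Lemma le_nlogn m : m.+2%:R * ln 2%:R <= nlogn R m.
Proof.
by rewrite ler_pM2l ?ltr0n // ler_ln ?posrE ?ltr0n // ler_nat.
Qed.

(** A linear term is absorbed by [n log n] because [n = m + 2 >= 2] keeps the
    logarithm above the positive constant [ln 2]. *)
Lemma eqO_nlogn_affine (f g : nat -> nat) (A B : nat) :
  (fun m => (f m)%:R : R) =O_\oo (@nlogn R) ->
  (forall m, (g m <= A * f m + B * m.+1)%N) ->
  (fun m => (g m)%:R : R) =O_\oo (@nlogn R).
Proof.
move=> /eqO_exP[k k0 hk] hg; apply/eqO_exP.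
have l2 : 0 < ln 2%:R :> R by apply: ln_gt0; rewrite ltr1n.
(* The final [1] makes the constant positive. *)
exists (A%:R * k + B%:R / ln 2%:R + 1).
  by apply: ltr_wpDl => //; rewrite addr_ge0 ?divr_ge0 ?mulr_ge0 ?ler0n // ltW.
near=> m.
have hm : `|(f m)%:R : R| <= k * `|nlogn R m| by near: m; exact: hk.
have n0 : 0 <= nlogn R m.
  by apply: le_trans (le_nlogn m); rewrite mulr_ge0 // ltW.
rewrite ger0_norm // (ger0_norm n0); rewrite ger0_norm // (ger0_norm n0) in hm.
have h1 : (g m)%:R <= A%:R * (f m)%:R + B%:R * m.+1%:R :> R.
  by rewrite -!natrM -natrD ler_nat.
apply: le_trans h1 _; rewrite !mulrDl mul1r -addrA lerD //.
  by rewrite -mulrA ler_wpM2l.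
apply: le_trans (_ : B%:R / ln 2%:R * nlogn R m <= _); last by rewrite lerDl.
rewrite -mulrA ler_wpM2l // ler_pdivlMl // mulrC.
apply: le_trans (le_nlogn m).
by rewrite ler_wpM2r ?ler_nat // ltW.
Unshelve. all: by end_near.
Qed.

End Asymptotics.

Lemma slp_overS (F : fieldType) (K K' : set F) p (P : slp F p) :
  K `<=` K' -> slp_over K P -> slp_over K' P.
Proof.
move=> sub [h1 h2]; have subo o : operand_over K o -> operand_over K' o.
  by case: o => //= x /sub.
by split=> [k s /h1[/subo ? /subo]|i]; [|exact/subo/h2].
Qed.

Theorem theorem1 (R : realType) (a b : nat -> R) (K : nat -> set R[i])
    (X : forall m : nat, 'M[R[i]]_m) (ca cb : forall m : nat, 'cV[R[i]]_m)
    (hab : forall m : nat, a m < b m)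
    (hX : trig_transform K X)
    (hJ : forall m : nat, flip R[i] m *m X m *m flip R[i] m = X m)
    (hT : forall m : nat,
       TX (qvec (a m) (b m) (1 + m + 1)) (X m) (ca m) (cb m) \in unitmx) :
  fast_product
    (fun m : nat => data (K m) (qvec (a m) (b m) (1 + m + 1)) (ca m) (cb m))
    (fun m : nat =>
       invmx (TX (qvec (a m) (b m) (1 + m + 1)) (X m) (ca m) (cb m))).
Proof.
have [Xunit [P [KP PX costP]] _] := hX.
have flipE k (q : 'cV[R[i]]_k) i : (flip _ k *m q) i ord0 = q (rev_ord i) ord0.
  rewrite mxE (bigD1 (rev_ord i)) //= mxE eqxx mul1r big1 ?addr0 // => j.
  by rewrite mxE => /negPf ->; rewrite mul0r.
have solve m : exists Q : slp R[i] (1 + m + 1),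
    [/\ slp_over (data (K m) (qvec (a m) (b m) (1 + m + 1)) (ca m) (cb m)) Q,
        forall y, computes Q y
          (invmx (TX (qvec (a m) (b m) (1 + m + 1)) (X m) (ca m) (cb m)) *m y)
      & (cost Q <= 3 * cost (P m) + 36 * m.+1)%N].
  apply: (slp_solve_bordered (Xunit m) (hT m) _ (PX m)).
  - by apply: slp_overS (KP m) => z Kz; left; left; left.
  - by move=> i; left; left; right; exists i.
  - by move=> i; rewrite flipE; left; left; right; exists (rev_ord i).
  - by move=> i; left; right; exists i.
  - by move=> i; right; exists i.
exists (fun m => projT1 (cid (solve m))); split.
- by move=> m; case: (cid _) => Q [].
- by move=> m y; case: (cid _) => Q [].
- apply: (eqO_nlogn_affine (A := 3) (B := 36) costP) => m.
  by case: (cid _) => Q [].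
Qed.
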